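(* Let $k,s_1,s_2$ be non-negative integers, let $1<p<\frac{s_1+s_2+s_2k+k+3}{s_1+s_2+s_2k+k+1}$, and let $X_1=\frac{\partial}{\partial x_1}$, $X_2=x_1^k\frac{\partial}{\partial x_2}$ and $X_3=x_1^{s_1}x_2^{s_2}\frac{\partial}{\partial x_3}$ on $\mathbb{R}^3$, with $X=(X_1,X_2,X_3)$. Let $u_0\in L^1_{\mathrm{loc}}(\mathbb{R}^3)$. If $f\in L^1_{\mathrm{loc}}(\mathbb{R}^3)$ with $\int_{\mathbb{R}^3}f(x)\,dx>0$, then the problem $u_t-\Delta_X u=|u|^p+f(x)$ in $(0,\infty)\times\mathbb{R}^3$, $u(0,x)=u_0(x)$, does not admit a global in time weak solution.
   Context: For a system $X=(X_1,\dots,X_m)$ of real $C^\infty$ vector fields, $\Delta_X=-\sum_{k=1}^m X_k^\ast X_k$ with $X_k^\ast=-X_k-\operatorname{div}X_k$; here the vector fields are divergence free, so $\Delta_X=X_1^2+X_2^2+X_3^2$. Weak solution (with $n=3$): for $f,u_0\in L^1_{\mathrm{loc}}(\mathbb{R}^n)$, a function $u\in L^p_{\mathrm{loc}}((0,T),L^p_{\mathrm{loc}}(\mathbb{R}^n))$ is a local in time weak solution (on $[0,T)$) of $u_t-\Delta_X u=|u|^p+f(x)$, $u(0,x)=u_0(x)$, if for every non-negative test function $\psi\in C^1_c([0,T);C^2_c(\mathbb{R}^n))$ one has $\int_0^T\!\int_{\mathbb{R}^n}|u|^p\psi+\int_{\mathbb{R}^n}u_0\psi(0,x)+\int_0^T\!\int_{\mathbb{R}^n}f\psi+\int_0^T\!\int_{\mathbb{R}^n}u\psi_t+\int_0^T\!\int_{\mathbb{R}^n}u\,\Delta_X\psi=0$.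 When $T=\infty$, such $u$ is called a global in time weak solution. *)

(* Defs.v *)
(* Written with MathComp and MathComp-Analysis. *)
From HB Require Import structures.
From mathcomp Require Import all_boot all_order all_algebra.
From mathcomp Require Import all_classical all_reals all_analysis.

Set Implicit Arguments.
Unset Strict Implicit.
Unset Printing Implicit Defensive.

Import Order.TTheory GRing.Theory Num.Theory.
Import numFieldNormedType.Exports.

Local Open Scope classical_set_scope.
Local Open Scope ring_scope.

(* The space R^3, with its product topology and normed module structure. *)
Notation R3 R := (R * R * R)%type.

(* The same carrier with its product (= Borel) sigma-algebra: the library puts
   the sigma-algebra on which [lebesgue_measure] lives on the alias
   [measurableTypeR R] of [R]. *)
Definition borelR3 (R : realType) : Type :=
  (measurableTypeR R * measurableTypeR R * measurableTypeR R)%type.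

HB.instance Definition _ (R : realType) := Measurable.on (borelR3 R).

Definition lebesgue3 {R : realType} : set (borelR3 R) -> \bar R :=
  (@lebesgue_measure R \x @lebesgue_measure R \x @lebesgue_measure R)%E.

HB.instance Definition _ (R : realType) := Measure.on (@lebesgue3 R).

Section vector_fields.
Context {R : realType}.
Implicit Types (g : R3 R -> R) (x : R3 R) (i : 'I_3).

Definition unit_vec i : R3 R :=
  ((i == 0%N :> nat)%:R, (i == 1%N :> nat)%:R, (i == 2%N :> nat)%:R).

Definition pderiv i g : R3 R -> R := fun x => 'D_(unit_vec i) g x.

(* [Y i] is the coefficient of the i-th partial derivative in the field [Y] *)
Definition vector_field := 'I_3 -> R3 R -> R.

Implicit Types Y : vector_field.

Definition vf_apply Y g : R3 R -> R := fun x => \sum_(i < 3) Y i x * pderiv i g x.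

Definition divergence Y : R3 R -> R := fun x => \sum_(i < 3) pderiv i (Y i) x.

Definition vf_adjoint Y g : R3 R -> R :=
  fun x => - vf_apply Y g x - divergence Y x * g x.

Definition sub_laplacian m (X : 'I_m -> vector_field) g : R3 R -> R :=
  fun x => - \sum_(k < m) vf_adjoint (X k) (vf_apply (X k) g) x.

Fixpoint Cn (n : nat) g : Prop :=
  continuous g /\
  if n is n'.+1
  then forall i, (forall x, derivable g x (unit_vec i)) /\ Cn n' (pderiv i g)
  else True.

(* C^2_c(R^3) *)
Definition C2c g : Prop := Cn 2 g /\ compact (closure [set x | g x != 0]).

Definition unif_cvg (F : set_system R) (h : R -> R3 R -> R) g : Prop :=
  forall e : R, 0 < e -> \forall s \near F, forall x, `|h s x - g x| < e.

(* convergence in the C^2 norm, i.e. uniform convergence of all the partial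
   derivatives of order at most 2 *)
Definition C2_cvg (F : set_system R) (h : R -> R3 R -> R) g : Prop :=
  [/\ unif_cvg F h g,
      forall i, unif_cvg F (fun s => pderiv i (h s)) (pderiv i g)
    & forall i j, unif_cvg F (fun s => pderiv i (pderiv j (h s)))
                             (pderiv i (pderiv j g))].

End vector_fields.

Arguments vector_field R : clear implicits.

Section weak_solutions.
Context {R : realType}.
Implicit Types (T : \bar R) (p : R) (f : R3 R -> R) (u : R * R3 R -> R).

(* [0, T) and (0, T), where T = +oo is allowed *)
Definition times T : set R := [set t | 0 <= t /\ (t%:E < T)%E].
Definition pos_times T : set R := [set t | 0 < t /\ (t%:E < T)%E].

(* C^1_c([0,T); C^2_c(R^3)): C^1 curves of functions of C^2_c(R^3), with compact
   support in [0,T).  Such a curve stays in the functions supported in a fixed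
   compact set [K], where the topology is given by the C^2 norm; its derivative
   [dpsi] (one-sided at 0) is taken for this norm. *)
Definition test_function T (psi : R -> R3 R -> R) : Prop :=
  (exists (b : R) (K : set (R3 R)), [/\ (b%:E < T)%E, compact K
     & forall t x, times T t -> psi t x != 0 -> t <= b /\ K x]) /\
  (exists dpsi : R -> R3 R -> R, forall t, times T t ->
     [/\ C2c (psi t), C2c (dpsi t),
         C2_cvg (within (times T `\ t) (nbhs t))
           (fun s x => (psi s x - psi t x) / (s - t)) (dpsi t)
       & C2_cvg (within (times T) (nbhs t)) dpsi (dpsi t)]).

(* L^1_loc(R^3) *)
Definition L1_loc f : Prop :=
  measurable_fun (setT : set (borelR3 R)) f /\
  forall K : set (R3 R), compact K -> (\int[lebesgue3]_(x in K) `|f x|%:E < +oo)%E.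

(* L^p_loc((0,T), L^p_loc(R^3)) *)
Definition Lp_loc T p u : Prop :=
  measurable_fun (pos_times T `*` setT : set (measurableTypeR R * borelR3 R)) u /\
  forall (I : set R) (K : set (R3 R)),
    I `<=` pos_times T -> compact I -> compact K ->
    (\int[lebesgue_measure]_(t in I)
       \int[lebesgue3]_(x in K) (`|u (t, x)| `^ p)%:E < +oo)%E.

(* Weak solutions on [0,T) of u_t - Delta_X u = |u|^p + f, u(0,.) = u0.
   The integrals are \bar R-valued, and a sum in \bar R is 0 only if all its
   terms are finite; since the integral of a function whose positive and
   negative parts both have infinite integral is -oo, the equation includes the
   existence of the five integrals. *)
Definition weak_solution m (X : 'I_m -> vector_field R) p f (u0 : R3 R -> R) T u : Prop :=
  Lp_loc T p u /\
  forall psi : R -> R3 R -> R, test_function T psi ->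
    (forall t x, times T t -> 0 <= psi t x) ->
    (\int[lebesgue_measure]_(t in pos_times T)
        \int[lebesgue3]_x (`|u (t, x)| `^ p * psi t x)%:E
     + \int[lebesgue3]_x (u0 x * psi 0%R x)%:E
     + \int[lebesgue_measure]_(t in pos_times T)
        \int[lebesgue3]_x (f x * psi t x)%:E
     + \int[lebesgue_measure]_(t in pos_times T)
        \int[lebesgue3]_x (u (t, x) * derive1 (psi ^~ x) t)%:E
     + \int[lebesgue_measure]_(t in pos_times T)
        \int[lebesgue3]_x (u (t, x) * sub_laplacian X (psi t) x)%:E = 0)%E.

Definition global_weak_solution m (X : 'I_m -> vector_field R) p f (u0 : R3 R -> R) u :=
  weak_solution X p f u0 +oo%E u.

End weak_solutions.

(* X_1 = d/dx_1, X_2 = x_1^k d/dx_2, X_3 = x_1^s1 x_2^s2 d/dx_3 *)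
Definition monomial_fields (R : realType) (k s1 s2 : nat) (j : 'I_3) :
    vector_field R :=
  fun i x => if i == j
    then nth 0 [:: 1; x.1.1 ^+ k; x.1.1 ^+ s1 * x.1.2 ^+ s2] j else 0.

Arguments monomial_fields R k s1 s2 j : clear implicits.

(* Main.v *)
(* Test-function method with the weights of the dilations adapted to X.  Give x_i
   the weight w_i with w_1 = 1, w_2 = k + 1, w_3 = s1 + s2 (k + 1) + 1, so that
   every X_j is homogeneous of degree 1 and the homogeneous dimension is
   Q = w_1 + w_2 + w_3.  Test the equation against
   psi(t, x) = Z(t, x)^m with
   Z(t, x) = (1 - t/tau)_+ * prod_i (1 - (x_i / r^(w_i))^2)_+.
   Then |psi_t| <= (m / tau) Z^(m-2) and |Delta_X psi| <= (12 m^2 / r^2) Z^(m-2).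
   For m large, Young's inequality gives
   |u| M Z^(m-2) <= |u|^p Z^m / 4 + M (4M)^(1/(p-1)) on the support of psi, which
   has measure of order tau r^Q; so the terms in u are absorbed and, dividing by
   tau and letting tau go to infinity, int f psi(0, .) is bounded by a multiple of
   r^(Q - 2 p/(p-1)).  This goes to 0 as r goes to infinity because p < Q/(Q-2),
   while int f psi(0, .) stays bounded below by some c > 0 because int f > 0. *)
Require Import Defs.
From HB Require Import structures.
From mathcomp Require Import all_boot all_order all_algebra.
From mathcomp Require Import all_classical all_reals all_analysis.
From mathcomp Require Import measurable_realfun zify ring lra.
Import Order.TTheory GRing.Theory Num.Theory.
Import numFieldNormedType.Exports.
Local Open Scope classical_set_scope.
Local Open Scope ring_scope.

(** * Truncated powers and one-variable bumps *)

Definition tpow {R : realType} (m : nat) (y : R) : R := Num.max 0 y ^+ m.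

Lemma tpow_continuous {R : realType} (m : nat) : continuous (@tpow R m).
Proof.
move=> y; apply: (@continuous_comp _ _ _ (fun z : R => Num.max 0 z) (fun z => z ^+ m)).
  by apply: continuous_max; [exact: cvg_cst|exact: cvg_id].
exact: exprn_continuous.
Qed.

(** Reduces a directional derivative on R^3 to one variable: along a coordinate direction, a product
    of one-variable functions is a single moving factor [g] times a frozen factor [c]. *)
Lemma is_derive_dir {R : realType} (f : R3 R -> R) (x v : R3 R) (g : R -> R)
    (s dg c : R) :
  is_derive s 1 g dg -> (forall h, f (h *: v + x) = g (h + s) * c) ->
  is_derive x v f (dg * c).
Proof.
move=> [gd gE] fE.
have E : (fun h : R => h^-1 *: ((f \o shift x) (h *: v) - f x)) =
    (fun h : R => (h^-1 *: ((g \o shift s) (h *: 1) - g s)) * c).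
  apply/funext => h /=; have := fE 0.
  rewrite scale0r !add0r => ->; rewrite fE.
  by rewrite /GRing.scale /= mulr1 -mulrBl mulrA.
split; first by rewrite /derivable E; apply: is_cvgMr_tmp; exact: gd.
rewrite /derive E.
by apply/cvg_lim => //; apply: cvgMr_tmp; rewrite -gE; exact: gd.
Qed.

(** Away from 0 the function is locally 0 or a plain power. At 0 the difference quotient is exactly
    [tpow n.+1], which is continuous and vanishes there. *)
Lemma is_derive_tpow {R : realType} (n : nat) (y : R) :
  is_derive y 1 (@tpow R n.+2) (n.+2%:R * tpow n.+1 y).
Proof.
have [y0|y0|->] := ltgtP y 0.
- have -> : n.+2%:R * tpow n.+1 y = 0.
    by rewrite /tpow max_l ?(ltW y0)// expr0n mulr0.
  apply: (@near_eq_is_derive _ _ _ (cst 0)).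
  near=> z; rewrite /tpow max_l ?expr0n//.
  by near: z; exact: lt_le_nbhsl.
- apply: (@near_eq_is_derive R R^o R^o (fun z : R => z ^+ n.+2)).
    near=> z; rewrite /tpow max_r//.
    by near: z; exact: lt_le_nbhsr.
  rewrite /tpow max_r ?(ltW y0)//.
  have := @is_deriveX R R^o id n.+2 y 1 1 (is_derive_id _ _).
  by rewrite exprfctE => /is_derive_eq; apply; rewrite /GRing.scale /= mulr1.
- rewrite /tpow maxxx expr0n mulr0.
  have L : (fun h : R => h^-1 *: ((@tpow R n.+2 \o shift 0) (h *: 1) - tpow n.+2 0))
      @ 0^' --> (0 : R).
    have -> : (fun h : R => h^-1 *: ((@tpow R n.+2 \o shift 0) (h *: 1) - tpow n.+2 0))
       = (@tpow R n.+1).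
      apply/funext => h /=; rewrite /tpow maxxx expr0n /= subr0 addr0.
      rewrite /GRing.scale /= mulr1; case: (leP h 0) => h0.
        by rewrite !expr0n mulr0.
      by rewrite exprS mulrA mulVf ?gt_eqF// mul1r.
    apply: cvg_within_filter.
    have := @tpow_continuous R n.+1 0.
    by rewrite /continuous_at {2}/tpow maxxx expr0n.
  split; first by apply/cvg_ex; eexists; exact: L.
  exact/cvg_lim.
Unshelve. all: by end_near. Qed.

Definition bump {R : realType} (m : nat) (a s : R) : R := tpow m (1 - (s / a) ^+ 2).
(** [dbump] and [ddbump] are closed forms of the first two derivatives of [bump m a]. Each
    differentiation costs at most one power of the cut, so an exponent of at least 3 keeps the
    second derivative continuous. *)
Definition dbump {R : realType} (m : nat) (a s : R) : R :=
  - (2 * m%:R / a) * (s / a) * bump m.-1 a s.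
Definition ddbump {R : realType} (m : nat) (a s : R) : R :=
  - (2 * m%:R / a ^+ 2) * bump m.-1 a s
  + (4 * m%:R * m.-1%:R / a ^+ 2) * (s / a) ^+ 2 * bump m.-2 a s.

Lemma is_derive_bump {R : realType} n (a s : R) :
  is_derive s 1 (bump n.+2 a) (dbump n.+2 a s).
Proof.
have D : is_derive s 1 (fun s : R => 1 - (s / a) ^+ 2) (- (2 * (s / a) / a)).
  apply: is_derive_eq.
  rewrite /GRing.scale /=.
  ring.
have := @is_derive1_comp _ (@tpow R n.+2) _ s _ _ (is_derive_tpow n _) D.
move/is_derive_eq; apply.
rewrite /dbump /bump /=; ring.
Qed.

Lemma is_derive_dbump {R : realType} n (a s : R) :
  is_derive s 1 (dbump n.+3 a) (ddbump n.+3 a s).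
Proof.
have D1 := is_derive_bump n a s.
rewrite (_ : dbump n.+3 a = (fun s => - (2 * n.+3%:R / a) * (s / a)) * bump n.+2 a)//.
apply: is_derive_eq.
rewrite /GRing.scale /= /ddbump /dbump /= -!exprVn; ring.
Qed.

Definition cut {R : realType} (a s : R) : R := Num.max 0 (1 - (s / a) ^+ 2).

Lemma cut_ge0 {R : realType} (a s : R) : 0 <= cut a s.
Proof. by rewrite /cut le_max lexx. Qed.

Lemma cut_le1 {R : realType} (a s : R) : cut a s <= 1.
Proof. by rewrite /cut ge_max ler01 gerBl sqr_ge0. Qed.

Lemma bumpE {R : realType} m (a s : R) : bump m a s = cut a s ^+ m.
Proof. by []. Qed.

Lemma cut_neq0 {R : realType} (a s : R) : 0 < a -> cut a s != 0 -> `|s| <= a.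
Proof.
move=> a0; apply: contra_neqT; rewrite -ltNge => h.
rewrite /cut max_l// subr_le0 -real_normK ?num_real// expr_ge1//.
by rewrite normrM normfV (gtr0_norm a0) ler_pdivlMr// mul1r ltW.
Qed.

Lemma cut_mono {R : realType} (a b s : R) : 0 < a -> a <= b -> cut a s <= cut b s.
Proof.
move=> a0 ab; rewrite /cut ge_max !le_max lexx/=; apply/orP; right.
rewrite lerD2l lerN2 !expr_div_n; apply: ler_wpM2l; first exact: sqr_ge0.
have b0 := lt_le_trans a0 ab.
by rewrite lef_pV2 ?posrE ?exprn_gt0// lerXn2r ?nnegrE// ltW.
Qed.

(** Where the cut is nonzero, [|s / a| <= 1], so the factor [s / a] is free; elsewhere both sides
    vanish. *)
Lemma norm_dbump_le {R : realType} n (a s : R) : 0 < a ->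
  `|dbump n.+2 a s| <= 2 * n.+2%:R / a * cut a s ^+ n.+1.
Proof.
move=> a0; rewrite /dbump bumpE /=.
have [->|c0] := eqVneq (cut a s) 0; first by rewrite expr0n !mulr0 normr0.
have sa : `|s / a| <= 1.
  by rewrite normrM normfV (gtr0_norm a0) ler_pdivrMr// mul1r cut_neq0.
rewrite !normrM normrN; rewrite [`|cut _ _ ^+ _|]ger0_norm; last exact/exprn_ge0/cut_ge0.
rewrite ler_wpM2r; [by []|exact/exprn_ge0/cut_ge0|].
rewrite (ger0_norm (_ : 0 <= 2 * _ / a)); last by rewrite divr_ge0 ?mulr_ge0// ltW.
rewrite -normrM -[leRHS]mulr1 ler_wpM2l// divr_ge0 ?mulr_ge0// ltW//.
Qed.

(** With [m = n.+3], the two terms have coefficients 2m <= 4m and 4m(m-1), whose bounds add up to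
    4m^2; the higher power of the cut is at most the lower one because the cut is at most 1. *)
Lemma norm_ddbump_le {R : realType} n (a s : R) : 0 < a ->
  `|ddbump n.+3 a s| <= 4 * n.+3%:R ^+ 2 / a ^+ 2 * cut a s ^+ n.+1.
Proof.
move=> a0; rewrite /ddbump !bumpE /=.
have [->|c0] := eqVneq (cut a s) 0; first by rewrite !expr0n !mulr0 add0r normr0.
have sa : (s / a) ^+ 2 <= 1.
  rewrite -real_normK ?num_real// expr_le1//.
  by rewrite normrM normfV (gtr0_norm a0) ler_pdivrMr// mul1r cut_neq0.
have c1 := cut_le1 a s; have c2 := cut_ge0 a s.
have E : cut a s ^+ n.+2 <= cut a s ^+ n.+1 by rewrite exprS ler_piMl// exprn_ge0.
have P0 : 0 <= cut a s ^+ n.+1 by rewrite exprn_ge0.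
have i0 : 0 <= (a ^+ 2)^-1 by rewrite invr_ge0 sqr_ge0.
apply: (le_trans (ler_normD _ _)).
have -> : 4 * n.+3%:R ^+ 2 / a ^+ 2 * cut a s ^+ n.+1 =
   4 * n.+3%:R / a ^+ 2 * cut a s ^+ n.+1 + 4 * n.+3%:R * n.+2%:R / a ^+ 2 * cut a s ^+ n.+1.
  rewrite [in LHS](_ : n.+3%:R ^+ 2 = n.+3%:R + n.+3%:R * n.+2%:R :> R); first by ring.
  by rewrite -natrM -natrD -natrX -mulnS.
apply: lerD.
  rewrite normrM normrN !ger0_norm ?mulr_ge0// ?exprn_ge0//.
  apply: ler_pM => //; rewrite ?mulr_ge0//.
  by rewrite ler_wpM2r// ler_wpM2r// ler_nat.
move: (_ ^+ 2) (sqr_ge0 (s / a)) sa => q q0 q1.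
rewrite ger0_norm ?mulr_ge0//.
rewrite ler_wpM2r// -[leRHS]mulr1 ler_wpM2l// !mulr_ge0//.
Qed.

(** * The test functions *)

Definition coord {R : realType} (x : R3 R) (i : nat) : R := nth 0 [:: x.1.1; x.1.2; x.2] i.

Definition bumpd {R : realType} (j m : nat) : R -> R -> R :=
  match j with 0 => bump m | 1 => dbump m | _ => ddbump m end.

(* [alpha i] is the order (at most 2) of the derivative in [x_i]; the scalar [e]
   stands for the value of the time profile. *)
Definition bump3 {R : realType} (m : nat) (a : nat -> R) (e : R) (alpha : nat -> nat)
    (x : R3 R) : R :=
  e * \prod_(i < 3) bumpd (alpha i) m (a i) (coord x i).

Definition incr (alpha : nat -> nat) (i : nat) : nat -> nat :=
  fun j => (alpha j + (j == i))%N.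

Lemma coordD {R : realType} (h : R) (i : 'I_3) (x : R3 R) (j : nat) :
  (j < 3)%N -> coord (h *: unit_vec i + x) j = h * (j == i)%:R + coord x j.
Proof.
by case: j => [|[|[|//]]] _; rewrite /coord /= /GRing.scale /= eq_sym.
Qed.

Lemma coord_continuous {R : realType} (i : nat) : continuous (fun x : R3 R => coord x i).
Proof.
case: i => [|[|[|i]]] x; rewrite /coord /=.
- apply: (@continuous_comp _ _ _ fst fst); exact: cvg_fst.
- apply: (@continuous_comp _ _ _ fst snd); [exact: cvg_fst|exact: cvg_snd].
- exact: cvg_snd.
- by rewrite nth_nil; exact: cvg_cst.
Qed.

Lemma is_derive_invariant {R : realType} (f : R3 R -> R) (x v : R3 R) :
  (forall h, f (h *: v + x) = f x) -> is_derive x v f 0.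
Proof.
move=> fE; rewrite -[0](mul0r (f x)).
by apply: (@is_derive_dir R f x v (cst 1) 0) => h; rewrite mul1r fE.
Qed.

Lemma bumpd_continuous {R : realType} (j n : nat) (a : R) :
  continuous (bumpd j n.+3 a).
Proof.
have csq : continuous (fun s : R => (s / a) ^+ 2).
  move=> s; rewrite /continuous_at expr2; apply: cvgM; apply: cvgMr_tmp; exact: cvg_id.
have cbump k : continuous (bump k a).
  move=> s; apply: (@continuous_comp _ _ _ (fun s : R => 1 - (s / a) ^+ 2) (tpow k)).
    apply: cvgB; first exact: cvg_cst.
    exact: csq.
  exact: tpow_continuous.
case: j => [|[|j]] s /=.
- exact: cbump.
- apply: cvgM; last exact: cbump.
  by apply: cvgMl_tmp; apply: cvgMr_tmp; exact: cvg_id.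
- apply: cvgD; first by apply: cvgMl_tmp; exact: cbump.
  apply: cvgM; last exact: cbump.
  by apply: cvgMl_tmp; exact: csq.
Qed.

Lemma is_derive_bumpd {R : realType} (j n : nat) (a s : R) : (j < 2)%N ->
  is_derive s 1 (bumpd j n.+3 a) (bumpd j.+1 n.+3 a s).
Proof.
by case: j => [|[|//]] _; [exact: is_derive_bump|exact: is_derive_dbump].
Qed.

Lemma bump3_continuous {R : realType} n a e alpha :
  continuous (@bump3 R n.+3 a e alpha).
Proof.
have cb i : continuous (fun x : R3 R => bumpd (alpha i) n.+3 (a i) (coord x i)).
  move=> x; apply: (@continuous_comp _ _ _ (fun x : R3 R => coord x i)).
    exact: coord_continuous.
  exact: bumpd_continuous.
rewrite (_ : bump3 _ _ _ _ = fun x => e * (1 * bumpd (alpha 0) n.+3 (a 0) (coord x 0)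
    * bumpd (alpha 1) n.+3 (a 1) (coord x 1) * bumpd (alpha 2) n.+3 (a 2) (coord x 2))).
  move=> x; apply: cvgMl_tmp; apply: cvgM; last exact: (cb 2).
  apply: cvgM; last exact: (cb 1).
  by apply: cvgMl_tmp; exact: (cb 0).
by apply/funext => x; rewrite /bump3 !big_ord_recr big_ord0.
Qed.

(** Only the factor of index [i] moves along [unit_vec i]; [e] and the other factors form the
    constant of [is_derive_dir]. *)
Lemma is_derive_bump3 {R : realType} n (a : nat -> R) e (alpha : nat -> nat) (i : 'I_3) x :
  (alpha i < 2)%N ->
  is_derive x (unit_vec i) (bump3 n.+3 a e alpha) (bump3 n.+3 a e (incr alpha i) x).
Proof.
move=> ai.
have D := @is_derive_bumpd R (alpha i) n (a i) (coord x i) ai.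
pose c := e * \prod_(j < 3 | j != i) bumpd (alpha j) n.+3 (a j) (coord x j).
have -> : bump3 n.+3 a e (incr alpha i) x = bumpd (alpha i).+1 n.+3 (a i) (coord x i) * c.
  rewrite /bump3 (bigD1 i)//= /incr eqxx addn1 mulrCA; congr (_ * (_ * _)).
  by apply: eq_bigr => j; rewrite -val_eqE => /negbTE /= ->; rewrite addn0.
apply: (is_derive_dir _ _ _ _ _ _ _ D) => h.
rewrite /bump3 (bigD1 i)//= coordD// eqxx mulr1 mulrCA; congr (_ * (_ * _)).
apply: eq_bigr => j; rewrite -val_eqE => /negbTE /= ji.
by rewrite coordD// ji mulr0 add0r.
Qed.

Lemma pderiv_bump3 {R : realType} n (a : nat -> R) e (alpha : nat -> nat) (i : 'I_3) :
  (alpha i < 2)%N ->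
  pderiv i (bump3 n.+3 a e alpha) = bump3 n.+3 a e (incr alpha i).
Proof. by move=> ai; apply/funext => x; have [] := is_derive_bump3 n a e alpha i x ai. Qed.

(** The family [bump3] is stable under partial derivatives, which raise one order by 1. The
    hypothesis reserves room for [k] more derivatives below order 2, which is what the induction
    consumes. *)
Lemma Cn_bump3 {R : realType} n (a : nat -> R) e (alpha : nat -> nat) k :
  (forall i, (alpha i + k <= 2)%N) -> Cn k (bump3 n.+3 a e alpha).
Proof.
elim: k alpha => [|k IH] alpha h /=; split=> //; try exact: bump3_continuous.
move=> i; have ai : (alpha i < 2)%N.
  by apply: leq_trans (h i); rewrite addnS ltnS leq_addr.
split; first by move=> x; have [] := is_derive_bump3 n a e alpha i x ai.
rewrite pderiv_bump3//; apply: IH => j; rewrite /incr.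
apply: leq_trans (h j); rewrite addnS -addSn leq_add2r.
by case: eqP; rewrite ?addn0 ?addn1.
Qed.

Definition box {R : realType} (a : nat -> R) : set (R3 R) :=
  (`[- a 0, a 0] `*` `[- a 1, a 1]) `*` `[- a 2, a 2].

Lemma boxP {R : realType} (a : nat -> R) x :
  box a x <-> forall i : 'I_3, `|coord x i| <= a i.
Proof.
rewrite /box /= !in_itv /= -!ler_norml; split.
  by move=> [[h0 h1] h2] [[|[|[|//]]] ?].
by move=> h; split; [split|]; [exact: (h (@Ordinal 3 0 isT))|
  exact: (h (@Ordinal 3 1 isT))|exact: (h (@Ordinal 3 2 isT))].
Qed.

Lemma compact_box {R : realType} (a : nat -> R) : compact (box a).
Proof. by apply: compact_setX; [apply: compact_setX|]; exact: segment_compact. Qed.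

Lemma bump3_supp {R : realType} n (a : nat -> R) e (alpha : nat -> nat) x :
  (forall i, 0 < a i) -> bump3 n.+3 a e alpha x != 0 ->
  forall i : 'I_3, cut (a i) (coord x i) != 0.
Proof.
move=> a0 h i; apply: contra_neq h => ci.
rewrite /bump3 (bigD1 i)//= (_ : bumpd _ _ _ _ = 0) ?mul0r ?mulr0//.
by case: (alpha i) => [|[|j]] /=; rewrite /ddbump /dbump !bumpE ci !expr0n /= ?mulr0 ?addr0.
Qed.

Lemma bump3_box {R : realType} n (a : nat -> R) e (alpha : nat -> nat) x :
  (forall i, 0 < a i) -> bump3 n.+3 a e alpha x != 0 -> box a x.
Proof. by move=> a0 h; apply/boxP => i; apply/cut_neq0 => //; apply: bump3_supp h i. Qed.

Lemma C2c_bump3 {R : realType} n (a : nat -> R) e : (forall i, 0 < a i) ->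
  C2c (bump3 n.+3 a e (fun=> 0%N)).
Proof.
move=> a0; split; first exact: Cn_bump3.
apply: (@subclosed_compact _ _ (box a)); [exact: closed_closure|exact: compact_box|].
rewrite [X in _ `<=` X](closure_id _).1.
  by apply: closure_subset => x /=; exact: bump3_box.
by apply: compact_closed; [exact: norm_hausdorff|exact: compact_box].
Qed.

Definition cut3 {R : realType} (a : nat -> R) (x : R3 R) : R :=
  \prod_(i < 3) cut (a i) (coord x i).

Lemma cut3_ge0 {R : realType} (a : nat -> R) x : 0 <= cut3 a x.
Proof. by apply: prodr_ge0 => i _; exact: cut_ge0. Qed.

Lemma cut3_le1 {R : realType} (a : nat -> R) x : cut3 a x <= 1.
Proof. by apply: prodr_ile1 => i _; rewrite cut_ge0 cut_le1. Qed.

Lemma cut3_mono {R : realType} (a b : nat -> R) x :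
  (forall i, 0 < a i <= b i) -> cut3 a x <= cut3 b x.
Proof.
move=> ab; apply: ler_prod => i _; rewrite cut_ge0 /=.
by have /andP[? ?] := ab i; exact: cut_mono.
Qed.

Lemma cut3_box {R : realType} (a : nat -> R) x : (forall i, 0 < a i) ->
  cut3 a x != 0 -> box a x.
Proof.
move=> a0 h; apply/boxP => i; apply: cut_neq0 => //; apply: contra_neq h => h.
by rewrite /cut3 (bigD1 i)//= h mul0r.
Qed.

Lemma bump3E {R : realType} (m : nat) (a : nat -> R) e x :
  bump3 m a e (fun=> 0%N) x = e * cut3 a x ^+ m.
Proof. by rewrite /bump3 /cut3 -prodrXl; congr (_ * _); apply: eq_bigr. Qed.

(** The bound is linear in [e] and uniform in [x], so that convergence of the scalar [e] becomes
    uniform convergence in space. *)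
Lemma bump3_bounded {R : realType} (n : nat) (a : nat -> R) (alpha : nat -> nat) :
  (forall i, 0 < a i) ->
  exists2 B : R, 0 < B & forall e x, `|bump3 n.+3 a e alpha x| <= `|e| * B.
Proof.
move=> a0.
have b1 i : exists B : R, 0 < B /\ forall s, `|bumpd (alpha i) n.+3 (a i) s| <= B.
  have P k s : cut (a i) s ^+ k <= 1 by rewrite exprn_ile1 ?cut_ge0 ?cut_le1.
  case: (alpha i) => [|[|j]] /=.
  - exists 1; split=> // s.
    by rewrite bumpE ger0_norm ?exprn_ge0 ?cut_ge0.
  - exists (2 * n.+3%:R / a i); split; first by rewrite divr_gt0.
    move=> s; apply: (le_trans (norm_dbump_le _ _ _ (a0 i))).
    by rewrite ler_piMr// divr_ge0// ltW.
  - exists (4 * n.+3%:R ^+ 2 / a i ^+ 2); split.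
      by rewrite divr_gt0// ?exprn_gt0// mulr_gt0// exprn_gt0.
    move=> s; apply: (le_trans (norm_ddbump_le _ _ _ (a0 i))).
    by rewrite ler_piMr// divr_ge0// ?mulr_ge0 ?exprn_ge0// ltW.
have [B hB] := choice b1.
exists (\prod_(i < 3) B i); first by apply: prodr_gt0 => i _; have [] := hB i.
move=> e x; rewrite /bump3 normrM ler_wpM2l// normr_prod.
by apply: ler_prod => i _; rewrite normr_ge0; have [_ ->] := hB i.
Qed.

(** [bump3] is linear in [e]: a difference of two such functions is [bump3] with scalar [e s - e0],
    and the same holds for every derivative up to order 2. *)
Lemma C2_cvg_bump3 {R : realType} (n : nat) (a : nat -> R) (F : set_system R)
    (e : R -> R) (e0 : R) : Filter F -> (forall i, 0 < a i) ->
  e s @[s --> F] --> e0 ->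
  C2_cvg F (fun s => bump3 n.+3 a (e s) (fun=> 0%N)) (bump3 n.+3 a e0 (fun=> 0%N)).
Proof.
move=> FF a0 ee0.
have U alpha : unif_cvg F (fun s => bump3 n.+3 a (e s) alpha) (bump3 n.+3 a e0 alpha).
  have [B B0 hB] := bump3_bounded n a alpha a0.
  move=> d d0; have dB : 0 < d / B by rewrite divr_gt0.
  have := (@cvgr_distC_lt _ _ _ _ _ _ _ ee0 _ dB).
  move=> /(_ FF); apply: filterS => s es x.
  rewrite (_ : _ - _ = bump3 n.+3 a (e s - e0) alpha x); last by rewrite /bump3 mulrBl.
  by apply: (le_lt_trans (hB _ _)); rewrite -ltr_pdivlMr.
split; first exact: U.
- move=> i; rewrite pderiv_bump3//.
  by under eq_fun do rewrite pderiv_bump3//; exact: U.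
- move=> i j; rewrite pderiv_bump3// pderiv_bump3; last first.
    by rewrite /incr; case: (_ == _).
  under eq_fun do (rewrite pderiv_bump3// pderiv_bump3;
    last by rewrite /incr; case: (_ == _)).
  exact: U.
Qed.

(** * The time profile and the space-time test function *)

Definition tcut {R : realType} (tau t : R) : R := Num.max 0 (1 - t / tau).

Definition dtcut {R : realType} (m : nat) (tau t : R) : R :=
  - (m%:R / tau) * tcut tau t ^+ m.-1.

Lemma tcut_ge0 {R : realType} (tau t : R) : 0 <= tcut tau t.
Proof. by rewrite /tcut le_max lexx. Qed.

Lemma tcut_le1 {R : realType} (tau t : R) : 0 < tau -> 0 <= t -> tcut tau t <= 1.
Proof. by move=> tau0 t0; rewrite /tcut ge_max ler01 gerBl divr_ge0// ltW. Qed.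

Lemma tcut_neq0 {R : realType} (tau t : R) : 0 < tau -> tcut tau t != 0 -> t < tau.
Proof.
move=> tau0; apply: contra_neqT; rewrite -leNgt => h.
by rewrite /tcut max_l// subr_le0 ler_pdivlMr// mul1r.
Qed.

Lemma is_derive_tcut {R : realType} (n : nat) (tau t : R) :
  is_derive t 1 (fun t => tcut tau t ^+ n.+2) (dtcut n.+2 tau t).
Proof.
have D : is_derive t 1 (fun t : R => 1 - t / tau) (- tau^-1).
  apply: is_derive_eq; rewrite /GRing.scale /=; ring.
have := @is_derive1_comp _ (@tpow R n.+2) _ t _ _ (is_derive_tpow n _) D.
move/is_derive_eq; apply.
rewrite /dtcut /tpow /tcut /=; ring.
Qed.

Lemma tcut_continuous {R : realType} (n : nat) (tau : R) :
  continuous (fun t : R => tcut tau t ^+ n).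
Proof.
move=> t; apply: (@continuous_comp R R R (fun t : R => 1 - t / tau) (tpow n)).
  by apply: cvgB; [exact: cvg_cst|apply: cvgMr_tmp; exact: cvg_id].
exact: tpow_continuous.
Qed.

Definition psi {R : realType} (m : nat) (tau : R) (a : nat -> R) (t : R) : R3 R -> R :=
  bump3 m a (tcut tau t ^+ m) (fun=> 0%N).

(** Substitution h = s - t in the limit defining the derivative; removing [t] from [A] keeps h
    nonzero. Restricting to [A] covers the one-sided derivative at time 0. *)
Lemma is_derive_slope {R : realType} (f : R -> R) (t df : R) (A : set R) :
  is_derive t 1 f df ->
  (f s - f t) / (s - t) @[s --> within (A `\ t) (nbhs t)] --> df.
Proof.
move=> [fd <-].
have L : (s - t) @[s --> within (A `\ t) (nbhs t)] --> (0 : R)^'.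
  move=> P; rewrite /= !nbhs_simpl /= => P0.
  have T0 : (s - t) @[s --> t] --> (0 : R).
    by rewrite -(subrr t); apply: cvgB; [exact: cvg_id|exact: cvg_cst].
  have N : \forall s \near t, s - t != 0 -> P (s - t) := T0 _ P0.
  apply: filterS N => s h [_ st]; apply: h.
  by rewrite subr_eq0; apply/eqP.
have := cvg_comp _ _ L fd.
apply: cvg_trans; apply: near_eq_cvg; near=> s => /=.
by rewrite /GRing.scale /= mulr1 subrK mulrC.
Unshelve. all: by end_near. Qed.

(** The curve, its difference quotients and its derivative are one fixed spatial bump times a scalar
    in time, so both C^2 limits reduce to scalar limits through [C2_cvg_bump3]. *)
Lemma test_function_psi {R : realType} (n : nat) (tau : R) (a : nat -> R) :
  0 < tau -> (forall i, 0 < a i) -> test_function +oo%E (psi n.+3 tau a).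
Proof.
move=> tau0 a0; split.
  exists tau, (box a); split; [exact: ltry|exact: compact_box|].
  move=> t x _ h; split; last exact: bump3_box h.
  apply/ltW/tcut_neq0 => //; apply: contra_neq h => h.
  by rewrite /psi bump3E h expr0n mul0r.
exists (fun t => bump3 n.+3 a (dtcut n.+3 tau t) (fun=> 0%N)) => t _; split.
- exact: C2c_bump3.
- exact: C2c_bump3.
- rewrite (_ : (fun s x => _) = (fun s => bump3 n.+3 a
      ((tcut tau s ^+ n.+3 - tcut tau t ^+ n.+3) / (s - t)) (fun=> 0%N))).
    apply: C2_cvg_bump3 => //; exact: is_derive_slope (is_derive_tcut _ _ _).
  by apply/funext => s; apply/funext => x; rewrite /psi /bump3; ring.
- apply: C2_cvg_bump3 => //; apply: cvg_within_filter.
  apply: cvgMl_tmp; exact: tcut_continuous.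
Qed.

(** * The sub-Laplacian of the monomial fields on the test function *)

Definition mcoef {R : realType} (k s1 s2 : nat) (j : nat) (x : R3 R) : R :=
  nth 0 [:: 1; x.1.1 ^+ k; x.1.1 ^+ s1 * x.1.2 ^+ s2] j.

Lemma mcoef_shift {R : realType} (k s1 s2 : nat) (j : 'I_3) (h : R) x :
  mcoef k s1 s2 j (h *: unit_vec j + x) = mcoef k s1 s2 j x.
Proof.
by case: j => [[|[|[|//]]] ?]; rewrite /mcoef /= /GRing.scale /= ?mulr0 ?add0r.
Qed.

Lemma vf_apply_monomial {R : realType} k s1 s2 (j : 'I_3) (g : R3 R -> R) :
  vf_apply (monomial_fields R k s1 s2 j) g = fun x => mcoef k s1 s2 j x * pderiv j g x.
Proof.
apply/funext => x; rewrite /vf_apply (bigD1 j)//= /monomial_fields eqxx.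
by rewrite big1 ?addr0// => i /negbTE ->; rewrite mul0r.
Qed.

Lemma divergence_monomial {R : realType} k s1 s2 (j : 'I_3) (x : R3 R) :
  divergence (monomial_fields R k s1 s2 j) x = 0.
Proof.
rewrite /divergence big1// => i _; rewrite /pderiv /monomial_fields.
case: eqP => [->|_]; last exact: derive_cst.
apply: (@derive_val _ _ _ _ _ _ _ (is_derive_invariant _ _ _ _)) => h.
exact: mcoef_shift.
Qed.

(** The coefficient c_j of X_j does not depend on x_j. Hence X_j is divergence free and does not
    differentiate its own coefficient, so X_j^2 is c_j^2 times the second derivative in x_j. *)
Lemma sub_laplacian_bump3 {R : realType} k s1 s2 n (a : nat -> R) e (x : R3 R) :
  sub_laplacian (monomial_fields R k s1 s2) (bump3 n.+3 a e (fun=> 0%N)) x =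
  \sum_(j < 3) mcoef k s1 s2 j x ^+ 2 * bump3 n.+3 a e (incr (incr (fun=> 0%N) j) j) x.
Proof.
rewrite /sub_laplacian -sumrN; apply: eq_bigr => j _.
rewrite /vf_adjoint divergence_monomial mul0r subr0 opprK !vf_apply_monomial.
rewrite pderiv_bump3//.
have D1 : is_derive x (unit_vec j) (mcoef k s1 s2 j) (0 : R).
  by apply: is_derive_invariant => h; exact: mcoef_shift.
have D2 : is_derive x (unit_vec j) (bump3 n.+3 a e (incr (fun=> 0%N) j))
   (bump3 n.+3 a e (incr (incr (fun=> 0%N) j) j) x).
  by apply: is_derive_bump3; rewrite /incr eqxx.
have := is_deriveM D1 D2 => /(@derive_val _ _ _ _ _ _ _).
rewrite /pderiv => ->.
by rewrite scaler0 addr0 /GRing.scale /= mulrA -expr2.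
Qed.

(** The factor differentiated twice keeps two fewer powers of its cut; the other two factors are
    lowered to the same power, which yields a power of [cut3]. *)
Lemma bump3_dd_le {R : realType} n (a : nat -> R) e (j : 'I_3) x :
  (forall i, 0 < a i) ->
  `|bump3 n.+3 a e (incr (incr (fun=> 0%N) j) j) x| <=
    `|e| * (4 * n.+3%:R ^+ 2 / a j ^+ 2 * cut3 a x ^+ n.+1).
Proof.
move=> a0; rewrite /bump3 normrM ler_wpM2l// /cut3 (bigD1 j)// [in leRHS](bigD1 j)//=.
rewrite normrM exprMn mulrA.
rewrite /incr eqxx /=.
apply: ler_pM => //.
  exact: norm_ddbump_le.
rewrite -prodrXl normr_prod; apply: ler_prod => i; rewrite -val_eqE => /negbTE /= ->.
rewrite normr_ge0 /= bumpE ger0_norm ?exprn_ge0 ?cut_ge0//.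
by rewrite exprS exprS mulrA ler_piMl ?exprn_ge0 ?mulr_ile1 ?cut_ge0 ?cut_le1.
Qed.

(** * Integral estimates *)

(* The integral of a nonnegative function is a supremum over simple functions, so
   [f] and [g] need not be measurable. *)
Lemma le_integral_ge0 d (T : measurableType d) {R : realType}
    (mu : {measure set T -> \bar R}) (D : set T) (f g : T -> \bar R) :
  (forall x, D x -> 0 <= f x)%E -> (forall x, D x -> f x <= g x)%E ->
  (\int[mu]_(x in D) f x <= \int[mu]_(x in D) g x)%E.
Proof.
move=> f0 fg; have g0 x : D x -> (0 <= g x)%E.
  by move=> Dx; apply: le_trans (f0 _ Dx) (fg _ Dx).
rewrite !ge0_integralE//; apply: ge_ereal_sup => _ [h hf <-].
apply: ereal_sup_ubound; exists h => // x; apply: (le_trans (hf x)).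
exact: lee_restrict.
Qed.

(** The positive part of [f] contributes at least 0 and its negative part is at most [g]. The bound
    makes sense even when the integral of [f] is infinite. *)
Lemma integral_geN d (T : measurableType d) {R : realType}
    (mu : {measure set T -> \bar R}) (D : set T) (f g : T -> \bar R) :
  (forall x, D x -> 0 <= g x)%E -> (forall x, D x -> - g x <= f x)%E ->
  (- (\int[mu]_(x in D) g x) <= \int[mu]_(x in D) f x)%E.
Proof.
move=> g0 fg; rewrite [leRHS]integralE -[leLHS]add0e.
apply: leeB; first by apply: integral_ge0 => x _; exact: funepos_ge0.
apply: le_integral_ge0 => x Dx; first exact: funeneg_ge0.
by rewrite funenegE ge_max g0// andbT leeNl fg.
Qed.

Lemma measurable_box {R : realType} (a : nat -> R) : measurable (box a : set (borelR3 R)).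
Proof.
by apply: measurableX; [apply: measurableX|]; exact: measurable_itv.
Qed.

Lemma lebesgue3_box {R : realType} (a : nat -> R) : (forall i, 0 < a i) ->
  lebesgue3 (box a) = (8 * (a 0 * a 1 * a 2))%:E.
Proof.
move=> a0.
have L i : lebesgue_measure `[- a i, a i] = (2 * a i)%:E.
  rewrite lebesgue_measure_itv /= lte_fin gt0_cp// ?oppr_lt0//.
  by rewrite -EFinD opprK mulr_natl mulr2n.
transitivity ((2 * a 0)%:E * (2 * a 1)%:E * (2 * a 2)%:E)%E; last first.
  by rewrite -!EFinM; congr (_%:E); ring.
apply: etrans (@product_measure1E _ _ _ _ R (lebesgue_measure \x lebesgue_measure)%E
  lebesgue_measure (`[- a 0, a 0] `*` `[- a 1, a 1]) `[- a 2, a 2] _ _) _.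
- by apply: measurableX; exact: measurable_itv.
- exact: measurable_itv.
congr (_ * _)%E; last exact: L.
apply: etrans (@product_measure1E _ _ _ _ R lebesgue_measure
  lebesgue_measure `[- a 0, a 0] `[- a 1, a 1] _ _) _; try exact: measurable_itv.
by congr (_ * _)%E; exact: L.
Qed.

(** Exhaustion by cubes; sigma-finiteness gives access to Tonelli in [measurable_int3]. *)
Lemma lebesgue3_sigma_finite {R : realType} :
  sigma_finite (setT : set (borelR3 R)) (@lebesgue3 R).
Proof.
exists (fun n => box (fun=> n.+1%:R)).
  apply/esym/seteqP; split=> // x _.
  pose M := \sum_(i < 3) `|coord x i|.
  exists (Num.truncn M) => //; apply/boxP => i.
  apply: le_trans (ltW (truncnS_gt M)).
  by rewrite /M (bigD1 i)//= lerDl sumr_ge0.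
by move=> n; split; [exact: measurable_box|rewrite lebesgue3_box// ltry].
Qed.

HB.instance Definition _ (R : realType) :=
  Measure_isSigmaFinite.Build _ _ _ (@lebesgue3 R) lebesgue3_sigma_finite.

Lemma measurable_int3 {R : realType} (g : measurableTypeR R * borelR3 R -> \bar R) :
  measurable_fun (setT : set (measurableTypeR R * borelR3 R)) g -> (forall z, 0 <= g z)%E ->
  measurable_fun setT (fun t : measurableTypeR R => \int[lebesgue3]_x g (t, x))%E.
Proof.
move=> mg g0.
exact: (@measurable_fun_fubini_tonelli_F _ _ (measurableTypeR R) (borelR3 R) R
  lebesgue3 g mg g0).
Qed.

Lemma measurable_coord {R : realType} (i : nat) :
  measurable_fun (setT : set (borelR3 R)) (fun x : R3 R => coord x i).
Proof.
case: i => [|[|[|i]]]; rewrite /coord /=.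
- apply: (measurableT_comp measurable_fst measurable_fst).
- apply: (measurableT_comp measurable_snd measurable_fst).
- exact: measurable_snd.
- by rewrite nth_nil; exact: measurable_cst.
Qed.

Lemma measurable_cut3 {R : realType} (a : nat -> R) :
  measurable_fun (setT : set (borelR3 R)) (cut3 a).
Proof.
rewrite /cut3; apply: measurable_prod => i _.
apply: (measurableT_comp _ (measurable_coord i)).
apply: measurable_maxr; first exact: measurable_cst.
apply: measurable_funB; first exact: measurable_cst.
by apply: measurable_funX; apply: measurable_funM.
Qed.

Lemma measurable_tcut {R : realType} (tau : R) :
  measurable_fun (setT : set (measurableTypeR R)) (tcut tau).
Proof.
apply: measurable_maxr; first exact: measurable_cst.
apply: measurable_funB; first exact: measurable_cst.
exact: measurable_funM.
Qed.

(* With U = |u| and Z^(n+3) the test function, this trades Z^(n+1), which bounds its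
   derivatives, for Z^(n+3): either U^(p-1) Z^2 >= 4 M, or U Z^(2/(p-1)) is small. *)
Lemma young_absorb {R : realType} (p U M Z : R) (n : nat) :
  1 < p -> 2 * (p - 1)^-1 <= n.+1%:R -> 0 <= U -> 0 <= M -> 0 < Z <= 1 ->
  U * (M * Z ^+ n.+1) <= U `^ p * Z ^+ n.+3 / 4 + M * (4 * M) `^ (p - 1)^-1.
Proof.
move=> p1 hn U0 M0 /andP[Z0 Z1].
have p10 : 0 < p - 1 by rewrite subr_gt0.
have q0 : 0 < (p - 1)^-1 by rewrite invr_gt0.
have Zge0 := ltW Z0.
have Zn k : 0 <= Z ^+ k by rewrite exprn_ge0// ltW.
have [h|h] := leP (4 * M) (U `^ (p - 1) * Z ^+ 2).
  apply: (@le_trans _ _ (U `^ p * Z ^+ n.+3 / 4)); last first.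
    by rewrite lerDl mulr_ge0// powR_ge0.
  rewrite -(mulr_powRB1 U0 (lt_trans ltr01 p1)) -[n.+3]addn2 exprD ler_pdivlMr//.
  rewrite [leLHS](_ : _ = U * Z ^+ n.+1 * (4 * M)); last by ring.
  rewrite [leRHS](_ : _ = U * Z ^+ n.+1 * (U `^ (p - 1) * Z ^+ 2)); last by ring.
  by rewrite ler_wpM2l// mulr_ge0.
apply: (@le_trans _ _ (M * (4 * M) `^ (p - 1)^-1)); last first.
  by rewrite lerDr divr_ge0// mulr_ge0// powR_ge0.
rewrite mulrCA ler_wpM2l//.
have Up0 := powR_ge0 U (p - 1).
(* Raising U^(p-1) Z^2 < 4M to the power 1/(p-1) gives U Z^(2/(p-1)) <= (4M)^(1/(p-1)); then Z^(n+1)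
   <= Z^(2/(p-1)) because Z <= 1 and 2/(p-1) <= n+1. *)
have := @ge0_ler_powR R (p - 1)^-1 (ltW q0) (U `^ (p - 1) * Z ^+ 2) (4 * M).
rewrite !nnegrE !mulr_ge0// => /(_ isT isT (ltW h)).
apply: le_trans; rewrite powRM// -powRrM mulfV ?gt_eqF// powRr1// ler_wpM2l//.
rewrite -(powR_mulrn 2 Zge0) -powRrM -(powR_mulrn n.+1 Zge0).
by apply: ger_powR => //; rewrite Z0.
Qed.

Lemma pos_timesE {R : realType} : pos_times +oo%E = `]0, +oo[%classic :> set R.
Proof.
by apply/seteqP; split=> t /=; rewrite in_itv /= andbT; [case|rewrite /pos_times /= ltry].
Qed.

Lemma measurable_pos_times {R : realType} :
  measurable (pos_times +oo%E : set (measurableTypeR R)).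
Proof. by rewrite pos_timesE; exact: measurable_itv. Qed.

Lemma psiE {R : realType} m (tau : R) a t x :
  psi m tau a t x = (tcut tau t * cut3 a x) ^+ m.
Proof. by rewrite /psi bump3E exprMn. Qed.

(** * Absorption of the terms in [u] *)

Section absorption.
Context {R : realType} (p tau M : R) (n : nat) (a : nat -> R) (u w : R * R3 R -> R).
Context (p1 : 1 < p) (tau0 : 0 < tau) (M0 : 0 <= M) (a0 : forall i, 0 < a i)
  (hn : 2 * (p - 1)^-1 <= n.+1%:R)
  (mu : measurable_fun
    (pos_times +oo%E `*` setT : set (measurableTypeR R * borelR3 R)) u)
  (hw : forall (t : R) x, 0 < t ->
    `|w (t, x)| <= M * (tcut tau t * cut3 a x) ^+ n.+1).

Let K := M * (4 * M) `^ (p - 1)^-1.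
Let V := 8 * (a 0 * a 1 * a 2).
Let J (z : R * R3 R) : \bar R := (`|u z| `^ p * psi n.+3 tau a z.1 z.2)%:E.
Let D : set (measurableTypeR R * borelR3 R) := pos_times +oo%E `*` setT.
(** [u] is measurable over positive times; extension by zero gives a function measurable on the
    whole product, to which Tonelli applies. *)
Let J' : measurableTypeR R * borelR3 R -> \bar R := J \_ D.

Let K0 : 0 <= K. Proof. by rewrite mulr_ge0// powR_ge0. Qed.

Let V0 : 0 <= V. Proof. by rewrite !mulr_ge0// ltW. Qed.

Let psi0 t x : 0 <= psi n.+3 tau a t x.
Proof. by rewrite psiE exprn_ge0// mulr_ge0 ?tcut_ge0 ?cut3_ge0. Qed.

Let J0 z : (0 <= J z)%E.
Proof. by rewrite lee_fin mulr_ge0// powR_ge0. Qed.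

Let mJ' : measurable_fun setT J'.
Proof.
have mD : measurable D by apply: measurableX; [exact: measurable_pos_times|].
suff mJ : measurable_fun D J by exact: (measurable_restrictT J mD).1.
apply/measurable_EFinP; apply: measurable_funM.
  apply: (measurableT_comp (measurable_powR _)).
  exact: (measurableT_comp (@normr_measurable R setT) mu).
apply: measurable_funTS.
rewrite (_ : (fun z : measurableTypeR R * borelR3 R => _) =
   fun z => (tcut tau z.1 * cut3 a z.2) ^+ n.+3); last first.
  by apply/funext => z; rewrite psiE.
apply: measurable_funX; apply: measurable_funM.
  exact: (measurableT_comp (measurable_tcut tau) measurable_fst).
exact: (measurableT_comp (measurable_cut3 a) measurable_snd).
Qed.

Let J'E t x : 0 < t -> J' (t, x) = J (t, x).
Proof. by move=> t0; rewrite /J' /patch mem_set//; split=> //; split=> //; rewrite ltry. Qed.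

(** [w] stands for either the time derivative or the sub-Laplacian of the test function.
    [young_absorb] is integrated over the support, contained in times below [tau] and the box of
    volume 8 a_0 a_1 a_2. Each use spends a quarter of the integral of |u|^p psi. *)
Lemma integral_absorb :
  (- ((4^-1)%:E * \int[lebesgue_measure]_(t in pos_times +oo%E)
        \int[lebesgue3]_x (`|u (t, x)| `^ p * psi n.+3 tau a t x)%:E
      + (M * (4 * M) `^ (p - 1)^-1 * (8 * (a 0 * a 1 * a 2)) * tau)%:E) <=
    \int[lebesgue_measure]_(t in pos_times +oo%E)
       \int[lebesgue3]_x (u (t, x) * w (t, x))%:E)%E.
Proof.
have mJt t : 0 < t -> measurable_fun (setT : set (borelR3 R)) (fun x => J (t, x)).
  move=> t0; rewrite (_ : (fun x => J (t, x)) = fun x => J' (t, x)).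
    exact: (measurable_fun_pair2 t mJ').
  by apply/funext => x; rewrite J'E.
have mI : measurable_fun (pos_times +oo%E : set (measurableTypeR R))
    (fun t => \int[lebesgue3]_x J (t, x))%E.
  apply: (eq_measurable_fun (fun t => \int[lebesgue3]_x J' (t, x))%E).
    move=> t; rewrite inE => -[t0 _]; apply: eq_integral => x _; exact: J'E.
  apply: measurable_funTS; apply: measurable_int3 => // z.
  exact: erestrict_ge0.
have I0 t : (0 <= \int[lebesgue3]_x J (t, x))%E by apply: integral_ge0.
have i0 (T : Type) (A : set T) y : 0 <= \1_A y :> R by rewrite indicE.
(* [B t] is the spatial integral of the Young constant [K] over the box, switched off after time
   [tau]. *)
pose B := fun t : R => (K * V * \1_(`]0, tau[%classic) t)%:E.
have B0 t : (0 <= B t)%E by rewrite lee_fin mulr_ge0// mulr_ge0.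
have mB : measurable_fun (pos_times +oo%E : set (measurableTypeR R)) B.
  apply/measurable_EFinP; apply: measurable_funM => //.
have -> : ((4^-1)%:E * \int[lebesgue_measure]_(t in pos_times +oo%E)
    (\int[lebesgue3]_x J (t, x)) + (K * V * tau)%:E =
  \int[lebesgue_measure]_(t in pos_times +oo%E)
    ((4^-1)%:E * (\int[lebesgue3]_x J (t, x)) + B t))%E.
  have mP := @measurable_pos_times R.
  have c0 : (0 <= (4^-1 : R)%:E)%E by rewrite lee_fin.
  rewrite [RHS]ge0_integralD//; [|by move=> t _; rewrite mule_ge0|exact: measurable_funeM].
  rewrite ge0_integralZl//; congr (_ + _)%E; rewrite /B.
  under eq_integral do rewrite EFinM.
  have KV0 : (0 <= (K * V)%:E)%E by rewrite lee_fin mulr_ge0.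
  have mi : measurable_fun (pos_times +oo%E : set (measurableTypeR R))
      (fun t => (\1_(`]0, tau[%classic) t : R)%:E) by apply/measurable_EFinP.
  rewrite ge0_integralZl//.
  rewrite integral_indic//.
  rewrite setIidl; last by rewrite pos_timesE => t /=; rewrite !in_itv /= => /andP[->].
  rewrite EFinM; congr (_ * _)%E; apply/esym.
  apply: (etrans (lebesgue_measure_itv _)).
  by rewrite /= lte_fin tau0 sube0.
apply: integral_geN => [t _|t [t0 _]].
  by rewrite adde_ge0// mule_ge0// lee_fin.
(* The bound at time [t] is gathered into one spatial integral, so that [integral_geN] applies a
   second time, now in [x]. *)
have -> : ((4^-1)%:E * (\int[lebesgue3]_x J (t, x)) + B t =
  \int[lebesgue3]_x ((4^-1)%:E * J (t, x) +
     (K * \1_(`]0, tau[%classic) t)%:E * (\1_(box a) x)%:E))%E.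
  have c0 : (0 <= (4^-1 : R)%:E)%E by rewrite lee_fin.
  have mb : measurable_fun (setT : set (borelR3 R)) (fun x => (\1_(box a) x : R)%:E).
    by apply/measurable_EFinP; apply: measurable_indic; exact: measurable_box.
  have Ki : (0 <= (K * \1_(`]0, tau[%classic) t)%:E)%E by rewrite lee_fin mulr_ge0.
  have mJ := mJt t t0.
  rewrite [RHS]ge0_integralD//; last 4 first.
  - by move=> x _; rewrite mule_ge0.
  - exact: measurable_funeM.
  - by move=> x _; rewrite mule_ge0// lee_fin.
  - exact: measurable_funeM.
  rewrite !ge0_integralZl//; congr (_ + _)%E.
  rewrite integral_indic; [|by []|exact: measurable_box].
  rewrite setIT; transitivity ((K * \1_(`]0, tau[%classic) t)%:E * V%:E)%E.
    by rewrite -EFinM /B mulrAC.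
  by congr (_ * _)%E; exact/esym/lebesgue3_box.
apply: integral_geN => x _.
  apply: adde_ge0; apply: mule_ge0 => //; rewrite lee_fin//; exact: mulr_ge0.
have : `|u (t, x) * w (t, x)| <=
  4^-1 * (`|u (t, x)| `^ p * psi n.+3 tau a t x) + K * \1_(`]0, tau[%classic) t * \1_(box a) x.
  rewrite normrM.
  (* [young_absorb] requires a positive cut-off. Where it vanishes, [hw] forces [w] to vanish; where
     it does not, the point lies in the support and both indicators equal 1. *)
  have [Z0|Z0] := eqVneq (tcut tau t * cut3 a x) 0.
    have /eqP -> : `|w (t, x)| == 0.
      by rewrite -normr_le0 normr_id; have := hw t x t0; rewrite Z0 expr0n mulr0.
    by rewrite mulr0 addr_ge0 // mulr_ge0 // mulr_ge0 // ?powR_ge0.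
  have : tcut tau t != 0 by apply: contra_neq Z0 => ->; rewrite mul0r.
  move=> /(tcut_neq0 _ _ tau0) ttau.
  have bx : box a x.
    by apply: cut3_box => //; apply: contra_neq Z0 => ->; rewrite mulr0.
  rewrite !indicE !mem_set//; last by rewrite /= in_itv /= t0.
  rewrite !mulr1 psiE mulrC [4^-1 * _]mulrC mulrC.
  apply: (@le_trans _ _ (`|u (t, x)| * (M * (tcut tau t * cut3 a x) ^+ n.+1))).
    by rewrite ler_wpM2l// hw.
  apply: young_absorb => //.
  rewrite lt_neqAle eq_sym Z0 /= mulr_ge0 ?tcut_ge0 ?cut3_ge0//=.
  by rewrite mulr_ile1 ?tcut_ge0 ?cut3_ge0 ?cut3_le1// tcut_le1// ltW.
rewrite ler_norml => /andP[+ _].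
by rewrite /J -!EFinM -EFinD -EFinN lee_fin.
Qed.
End absorption.

(** * Anisotropic scaling *)

Lemma integral_posneg d (T : measurableType d) {R : realType}
    (mu : {measure set T -> \bar R}) (g h : T -> R) : (forall x, 0 <= h x) ->
  (\int[mu]_x (g x * h x)%:E = \int[mu]_x (Num.max (g x) 0 * h x)%:E
     - \int[mu]_x (Num.max (- g x) 0 * h x)%:E)%E.
Proof.
move=> h0; rewrite integralE; congr (_ - _)%E; apply: eq_integral => x _.
  by rewrite funeposE -EFin_max -[X in Num.max _ X](mul0r (h x)) maxr_pMl.
by rewrite funenegE -EFinN -EFin_max -mulNr -[X in Num.max _ X](mul0r (h x)) maxr_pMl.
Qed.

Lemma ge0_integralZ_ge0 d (T : measurableType d) {R : realType}
    (mu : {measure set T -> \bar R}) (g : T -> R) (e : R) :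
  measurable_fun setT g -> (forall x, 0 <= g x) -> 0 <= e ->
  (\int[mu]_x (e * g x)%:E = e%:E * \int[mu]_x (g x)%:E)%E.
Proof.
move=> mg g0 e0; under eq_integral do rewrite EFinM.
by rewrite ge0_integralZl//; [exact/measurable_EFinP|move=> x _; rewrite lee_fin].
Qed.

Definition scale {R : realType} (wt : nat -> nat) (r : R) (i : nat) : R := r ^+ wt i.

(** Squeezed between 1 - s^2/(j+1) and 1, since a positive weight gives (j+1)^(2 wt i) >= j+1. *)
Lemma cvg_cut {R : realType} (wt : nat -> nat) (i : nat) (s : R) : (0 < wt i)%N ->
  cut (scale wt j.+1%:R i) s @[j --> \oo] --> (1 : R).
Proof.
move=> wi.
apply: (@squeeze_cvgr _ _ _ _ (fun j => 1 - s ^+ 2 * harmonic j) (fun=> 1)).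
- near=> j; rewrite /= cut_le1 andbT /cut le_max; apply/orP; right.
  rewrite lerD2l lerN2 expr_div_n ler_wpM2l ?sqr_ge0//.
  rewrite /harmonic lef_pV2 ?posrE ?exprn_gt0 ?ltr0n//.
  rewrite /scale -exprM -natrX ler_nat.
  by rewrite -[leqLHS]expn1 leq_pexp2l// muln_gt0 wi.
- rewrite -[X in _ --> X]subr0 -[X in _ - X](mulr0 (s ^+ 2)).
  apply: cvgB; first exact: cvg_cst.
  by apply: cvgMl_tmp; exact: cvg_harmonic.
- exact: cvg_cst.
Unshelve. all: by end_near. Qed.

Lemma cvg_cut3 {R : realType} (wt : nat -> nat) (m : nat) (x : R3 R) :
  (forall i, (0 < wt i)%N) ->
  cut3 (scale wt j.+1%:R) x ^+ m @[j --> \oo] --> (1 : R).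
Proof.
move=> w0; rewrite -[X in _ --> X](expr1n _ m).
apply: (@cvg_comp _ _ _ (fun j => cut3 (scale wt j.+1%:R) x) (fun y => y ^+ m)); last first.
  exact: exprn_continuous.
rewrite /cut3.
rewrite (_ : (fun _ => _) = fun j => 1 * cut (scale wt j.+1%:R 0) (coord x 0)
   * cut (scale wt j.+1%:R 1) (coord x 1) * cut (scale wt j.+1%:R 2) (coord x 2)); last first.
  by apply/funext => j; rewrite !big_ord_recr big_ord0.
have C i : cut (scale wt j.+1%:R i) (coord x i) @[j --> \oo] --> (1 : R) by exact: cvg_cut.
have := cvgM (cvgM (cvgM (cvg_cst (1 : R)) (C 0)) (C 1)) (C 2).
by rewrite !mulr1; exact.
Qed.

Lemma scale_mono {R : realType} (wt : nat -> nat) (r r' : R) i :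
  0 < r -> r <= r' -> 0 < scale wt r i <= scale wt r' i.
Proof.
move=> r0 rr; rewrite /scale exprn_gt0//= lerXn2r// nnegrE ltW//.
exact: lt_le_trans rr.
Qed.

(** By monotone convergence on the positive part of [f], its cut-off integral eventually exceeds the
    full integral of the negative part. The gap persists for larger [r]: the former grows with [r],
    while cutting off the negative part only decreases its integral. The scalar [e] is the value of
    the time profile. *)
Lemma integral_cut3_ge {R : realType} (wt : nat -> nat) (m : nat) (f : R3 R -> R) :
  (forall i, (0 < wt i)%N) ->
  measurable_fun (setT : set (borelR3 R)) f ->
  (0 < \int[lebesgue3]_x (f x)%:E)%E ->
  exists2 c : R, 0 < c & exists2 r0 : R, 1 <= r0 & forall r e : R, r0 <= r -> 0 <= e ->
    ((e * c)%:E <= \int[lebesgue3]_x (f x * (e * cut3 (scale wt r) x ^+ m))%:E)%E.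
Proof.
move=> w0 mf fpos.
pose fp (x : R3 R) : R := Num.max (f x) 0; pose fn (x : R3 R) : R := Num.max (- f x) 0.
have fp0 x : 0 <= fp x by rewrite /fp le_max lexx orbT.
have fn0 x : 0 <= fn x by rewrite /fn le_max lexx orbT.
have mfp : measurable_fun (setT : set (borelR3 R)) fp.
  by apply: measurable_maxr => //; exact: measurable_cst.
have mfn : measurable_fun (setT : set (borelR3 R)) fn.
  by apply: measurable_maxr; [exact: measurableT_comp|exact: measurable_cst].
pose phi (r : R) (x : R3 R) : R := cut3 (scale wt r) x ^+ m.
have phi0 r x : 0 <= phi r x by rewrite exprn_ge0// cut3_ge0.
have phi1 r x : phi r x <= 1 by rewrite exprn_ile1 ?cut3_ge0 ?cut3_le1.
have phim (r r' : R) x : 0 < r -> r <= r' -> phi r x <= phi r' x.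
  move=> r0 rr; rewrite lerXn2r ?nnegrE ?cut3_ge0//.
  by apply: cut3_mono => i; exact: scale_mono.
have mphi r : measurable_fun (setT : set (borelR3 R)) (phi r).
  by apply: measurable_funX; exact: measurable_cut3.
pose P (r : R) := (\int[lebesgue3]_x (fp x * phi r x)%:E)%E.
pose N := (\int[lebesgue3]_x (fn x)%:E)%E.
have N0 : (0 <= N)%E by apply: integral_ge0 => x _; rewrite lee_fin.
have fE : (\int[lebesgue3]_x (f x)%:E = \int[lebesgue3]_x (fp x)%:E - N)%E.
  rewrite integralE; congr (_ - _)%E; apply: eq_integral => x _.
    by rewrite funeposE -EFin_max.
  by rewrite funenegE -EFinN -EFin_max.
(* If [N] were infinite, the integral of [f] would be -oo, whatever the integral of the positive
   part. *)
have Nfin : N \is a fin_num.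
  rewrite ge0_fin_numE// ltNge leye_eq; apply/negP => /eqP NE.
  by move: fpos; rewrite fE NE; case: (integral _ _ _).
have [j Pj] : exists j : nat, (N < P j.+1%:R)%E.
  apply: contrapT => /forallNP H.
  have Pcvg : (P j.+1%:R @[j --> \oo] --> \int[lebesgue3]_x (fp x)%:E)%E.
    have := @cvg_monotone_convergence _ _ R lebesgue3 setT measurableT
      (fun j x => (fp x * phi j.+1%:R x)%:E).
    rewrite (_ : (fun x => limn _) = fun x => (fp x)%:E).
      apply.
      - by move=> n; apply/measurable_EFinP; exact: measurable_funM.
      - by move=> n x _; rewrite lee_fin mulr_ge0.
      - by move=> x _ k l kl; rewrite lee_fin ler_wpM2l// phim// ler_nat.
    apply/funext => x; apply/cvg_lim => //.
    apply: cvg_EFin; first exact: nearW.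
    rewrite -[X in _ --> X]mulr1; apply: cvgMl_tmp.
    exact: cvg_cut3.
  have : (\int[lebesgue3]_x (fp x)%:E <= N)%E.
    rewrite -(cvg_lim _ Pcvg)//; apply: lime_le; first by apply/cvg_ex; eexists; exact: Pcvg.
    by apply: nearW => j; rewrite leNgt; apply/negP/H.
  by rewrite leNgt -sube_gt0 -fE fpos.
(* The gap itself serves as [c] when it is finite; when it is +oo, 1 does. *)
have [c c0 cP] : exists2 c : R, 0 < c & (c%:E <= P j.+1%:R - N)%E.
  move: Pj; rewrite -sube_gt0; case: (P _ - N)%E => [y y0|_|//].
    by exists y.
  by exists 1 => //; rewrite leey.
exists c => //; exists j.+1%:R; first by rewrite ler1n.
move=> r e jr e0.
have E (g : R3 R -> R) : measurable_fun (setT : set (borelR3 R)) g -> (forall x, 0 <= g x) ->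
    (\int[lebesgue3]_x (g x * (e * phi r x))%:E = e%:E * \int[lebesgue3]_x (g x * phi r x)%:E)%E.
  move=> mg g0; under eq_integral do rewrite mulrCA.
  apply: ge0_integralZ_ge0 => //; first exact: measurable_funM.
  by move=> x; rewrite mulr_ge0.
rewrite integral_posneg; last by move=> x; exact: mulr_ge0 e0 (phi0 r x).
rewrite (E _ mfp fp0) (E _ mfn fn0).
apply: (@le_trans _ _ (e%:E * (P j.+1%:R - N))%E).
  by rewrite EFinM lee_wpmul2l// lee_fin.
rewrite muleBr//; last first.
  by apply: fin_num_adde_defl; rewrite fin_numN.
apply: leeB; rewrite lee_wpmul2l ?lee_fin//; apply: le_integral_ge0 => x _;
  rewrite lee_fin ?mulr_ge0//.
  by rewrite ler_wpM2l// phim.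
by rewrite ler_piMr.
Qed.

(* Homogeneous weights of [x_1], [x_2], [x_3]: the dilation of ratio [r] multiplies
   [x_(i+1)] by [r ^ hwt i]; the value at [i > 2] is junk. *)
Definition hwt (k s1 s2 i : nat) : nat := nth 1%N [:: 1; k.+1; (s1 + s2 * k.+1).+1]%N i.

Lemma hwt_gt0 k s1 s2 i : (0 < hwt k s1 s2 i)%N.
Proof. by case: i => [|[|[|i]]] //; rewrite /hwt /= nth_nil. Qed.

(** The coefficient of X_j is a monomial of weighted degree w_j - 1, and |x_i| <= r^(w_i) on the
    box. *)
Lemma mcoef_le {R : realType} (k s1 s2 : nat) (r : R) (j : 'I_3) (x : R3 R) :
  0 < r -> box (scale (hwt k s1 s2) r) x ->
  `|mcoef k s1 s2 j x| <= r ^+ (hwt k s1 s2 j).-1.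
Proof.
move=> r0 /boxP h.
have h0 := h (@Ordinal 3 0 isT); have h1 := h (@Ordinal 3 1 isT).
rewrite /scale /coord /hwt /= expr1 in h0 h1.
case: j => [[|[|[|//]]] ?]; rewrite /mcoef /hwt /=.
- by rewrite normr1 expr0.
- by rewrite normrX lerXn2r// nnegrE ltW.
- rewrite normrM !normrX exprD [(s2 * _)%N]mulnC exprM.
  by apply: ler_pM; rewrite ?exprn_ge0// lerXn2r// nnegrE ?exprn_ge0// ltW.
Qed.

(** The squared coefficient, at most r^(2 w_j - 2), meets the factor r^(-2 w_j) of the second
    derivative and leaves r^(-2) for every j; three terms with constant 4 give 12. *)
Lemma sub_laplacian_bump3_le {R : realType} k s1 s2 n (r e : R) (x : R3 R) :
  0 < r -> 0 <= e ->
  `|sub_laplacian (monomial_fields R k s1 s2)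
      (bump3 n.+3 (scale (hwt k s1 s2) r) e (fun=> 0%N)) x| <=
  12 * n.+3%:R ^+ 2 / r ^+ 2 * (e * cut3 (scale (hwt k s1 s2) r) x ^+ n.+1).
Proof.
move=> r0 e0; set a := scale _ _.
have a0 i : 0 < a i by rewrite /a /scale exprn_gt0.
have c0 : 0 <= cut3 a x ^+ n.+1 by rewrite exprn_ge0// cut3_ge0.
rewrite sub_laplacian_bump3.
have -> : 12 * n.+3%:R ^+ 2 / r ^+ 2 * (e * cut3 a x ^+ n.+1) =
    \sum_(j < 3) (4 * n.+3%:R ^+ 2 / r ^+ 2 * (e * cut3 a x ^+ n.+1)).
  by rewrite sumr_const card_ord -mulr_natl; ring.
apply: (le_trans (ler_norm_sum _ _ _)); apply: ler_sum => j _.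
rewrite normrM.
apply: (le_trans (ler_wpM2l _ (bump3_dd_le _ _ _ _ _ a0))) => //.
have [Z0|Z0] := eqVneq (cut3 a x) 0.
  by rewrite Z0 expr0n !mulr0.
rewrite (ger0_norm e0) normrX.
have ha : a j = r ^+ (hwt k s1 s2 j).-1 * r.
  by rewrite /a /scale -exprSr prednK// hwt_gt0.
have hm := mcoef_le k s1 s2 r j x r0 (cut3_box _ _ a0 Z0).
have hm2 : `|mcoef k s1 s2 j x| ^+ 2 / a j ^+ 2 <= (r ^+ 2)^-1.
  rewrite ler_pdivrMr ?exprn_gt0// ha exprMn mulrCA mulVf ?mulr1 ?gt_eqF ?exprn_gt0//.
  by rewrite lerXn2r// nnegrE exprn_ge0// ltW.
rewrite [leLHS](_ : _ = 4 * n.+3%:R ^+ 2 * (e * cut3 a x ^+ n.+1) *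
  (`|mcoef k s1 s2 j x| ^+ 2 / a j ^+ 2)); last by ring.
rewrite [leRHS](_ : _ = 4 * n.+3%:R ^+ 2 * (e * cut3 a x ^+ n.+1) * (r ^+ 2)^-1); last by ring.
by rewrite ler_wpM2l// !mulr_ge0//.
Qed.

(** * Choice of the parameters and conclusion *)

Lemma absorb_ineq {R : realType} (A B F D L : \bar R) (F0 d l : R) :
  (A + B + F + D + L = 0)%E -> (0 <= A)%E -> (F0%:E <= F)%E ->
  (- ((4^-1)%:E * A + d%:E) <= D)%E -> (- ((4^-1)%:E * A + l%:E) <= L)%E ->
  F0 + fine B <= d + l.
Proof.
move=> S.
(* A finite sum in [\bar R] has finite terms, which leaves real arithmetic: the bounds on [D] and
   [L] absorb half of [A], and the other half is nonnegative. *)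
have : (A + B + F + D + L)%E \is a fin_num by rewrite S.
rewrite !fin_numD => /andP[/andP[/andP[/andP[]]]].
move: A B F D L S => [A||] [B||] [F||] [D||] [L||]//.
rewrite -!EFinM -!EFinD -!EFinN !lee_fin => -[S] _ _ _ _ _ /=; lra.
Qed.

(** With q = 1/(p-1), the expression is a constant times r^(N - 2q), and p < (N+2)/N says exactly
    that 2q > N, so it decays in [r]. *)
Lemma choose_scale {R : realType} (N : nat) (p C kappa r0 : R) :
  1 < p -> p < N.+2%:R / N%:R -> 0 < C -> 0 < kappa -> 1 <= r0 ->
  exists2 r, r0 <= r & r ^+ N.+2 * (C / r ^+ 2 * (4 * (C / r ^+ 2)) `^ (p - 1)^-1) <= kappa.
Proof.
move=> p1 hp C0 k0 r01.
have N0 : (0 < N)%N.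
  by rewrite lt0n; apply/eqP => NE; move: hp;
  rewrite NE invr0 mulr0 ltNge (ltW (lt_trans ltr01 p1)).
have N0r : 0 < N%:R :> R by rewrite ltr0n.
have p10 : 0 < p - 1 by rewrite subr_gt0.
pose q := (p - 1)^-1.
have q0 : 0 < q by rewrite invr_gt0.
have qN : 0 < 2 * q - N%:R.
  rewrite subr_gt0 ltr_pdivlMr//.
  move: hp; rewrite ltr_pdivlMr// -addn2 natrD; lra.
pose de := 2 * q - N%:R.
pose E := C * (4 * C) `^ q.
have E0 : 0 < E by rewrite mulr_gt0// powR_gt0// mulr_gt0.
(* The second entry solves E / r^de = kappa. *)
pose r := Num.max r0 ((E / kappa) `^ de^-1).
exists r; first by rewrite le_max lexx.
have rr : 0 < r by rewrite lt_max (lt_le_trans ltr01 r01).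
have -> : r ^+ N.+2 * (C / r ^+ 2 * (4 * (C / r ^+ 2)) `^ q) = E / r `^ de.
  have r2 : (r ^+ 2)^-1 = r `^ (- 2%:R) by rewrite powR_invn// ltW.
  rewrite mulrA powRM ?mulr_ge0 ?invr_ge0 ?exprn_ge0 ?(ltW C0) ?(ltW rr)//.
  rewrite r2 -powRrM -[r ^+ N.+2]powR_mulrn ?(ltW rr)//.
  rewrite -[in RHS]powRN /E.
  rewrite (_ : - de = N.+2%:R + - 2%:R + - 2%:R * q); last first.
    by rewrite /de -addn2 natrD; ring.
  rewrite !powRD ?(gt_eqF rr) ?implybT//.
  ring.
rewrite ler_pdivrMr ?powR_gt0// -ler_pdivrMl// mulrC.
have h : (E / kappa) `^ de^-1 <= r by rewrite le_max lexx orbT.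
have := @ge0_ler_powR R de (ltW qN) _ _ _ _ h.
rewrite !nnegrE powR_ge0 (ltW rr) => /(_ isT isT).
by rewrite -powRrM mulVf ?gt_eqF// powRr1// divr_ge0// ltW.
Qed.

Lemma derive1_psi {R : realType} n (tau : R) a t x :
  derive1 (psi n.+3 tau a ^~ x) t = dtcut n.+3 tau t * cut3 a x ^+ n.+3.
Proof.
rewrite (_ : psi n.+3 tau a ^~ x = cut3 a x ^+ n.+3 *: (fun t => tcut tau t ^+ n.+3)).
  rewrite derive1E; have D := is_derive_tcut n.+1 tau t.
  have := is_deriveZ (cut3 a x ^+ n.+3) D => /(@derive_val _ _ _ _ _ _ _) ->.
  by rewrite /GRing.scale /= mulrC.
by apply/funext => s; rewrite /psi bump3E mulrC.
Qed.

(** The powers m-1 in time and m in space are both lowered to m-2, the power that the sub-Laplacian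
    also leaves. *)
Lemma derive1_psi_le {R : realType} n (tau : R) a t x : 0 < tau -> 0 < t ->
  `|derive1 (psi n.+3 tau a ^~ x) t| <=
    n.+3%:R / tau * (tcut tau t * cut3 a x) ^+ n.+1.
Proof.
move=> tau0 t0; rewrite derive1_psi /dtcut exprMn.
have T0 := tcut_ge0 tau t; have T1 := tcut_le1 tau t tau0 (ltW t0).
have C0 := cut3_ge0 a x; have C1 := cut3_le1 a x.
have M0 : 0 <= n.+3%:R / tau by rewrite divr_ge0// ltW.
have TT : tcut tau t ^+ n.+3.-1 <= tcut tau t ^+ n.+1 by apply: ler_wiXn2l => //; lia.
have CC : cut3 a x ^+ n.+3 <= cut3 a x ^+ n.+1 by apply: ler_wiXn2l => //; lia.
have Tp := exprn_ge0 n.+3.-1 T0; have Cp := exprn_ge0 n.+3 C0.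
move: Tp Cp TT CC.
move: (_ ^+ n.+3.-1) (cut3 a x ^+ n.+3) => X Y X0 Y0 TT CC.
rewrite mulNr mulNr normrN ger0_norm; last by apply: mulr_ge0 => //; exact: mulr_ge0.
rewrite -[leLHS]mulrA ler_wpM2l//.
exact: ler_pM.
Qed.

Lemma sub_laplacian_psi_le {R : realType} k s1 s2 n (tau r : R) t x :
  0 < tau -> 0 < t -> 0 < r ->
  `|sub_laplacian (monomial_fields R k s1 s2)
      (psi n.+3 tau (scale (hwt k s1 s2) r) t) x| <=
  12 * n.+3%:R ^+ 2 / r ^+ 2 *
    (tcut tau t * cut3 (scale (hwt k s1 s2) r) x) ^+ n.+1.
Proof.
move=> tau0 t0 r0; have T0 := tcut_ge0 tau t.
have T1 := tcut_le1 tau t tau0 (ltW t0).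
apply: (le_trans (sub_laplacian_bump3_le _ _ _ _ _ _ _ r0 _)); first exact: exprn_ge0.
rewrite ler_wpM2l ?divr_ge0 ?mulr_ge0 ?exprn_ge0 ?(ltW r0)// exprMn.
apply: ler_wpM2r; first by apply: exprn_ge0; exact: cut3_ge0.
by apply: ler_wiXn2l => //; lia.
Qed.

(** The exponent is the sum of the weights, the homogeneous dimension Q, in the form [N.+2] of
    [choose_scale]. *)
Lemma prod_scale_hwt {R : realType} k s1 s2 (r : R) :
  let a := scale (hwt k s1 s2) r in
  a 0 * a 1 * a 2 = r ^+ (s1 + s2 + s2 * k + k + 1).+2.
Proof.
rewrite /= /scale /hwt /= -!exprD; congr (_ ^+ _).
by rewrite mulnS; lia.
Qed.

Theorem corollary4p13 (R : realType) (k s1 s2 : nat) (p : R)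
    (hp1 : 1 < p)
    (hp2 : p < (s1 + s2 + s2 * k + k + 3)%:R / (s1 + s2 + s2 * k + k + 1)%:R)
    (u0 f : R3 R -> R)
    (hu0 : L1_loc u0) (hf : L1_loc f)
    (hfpos : (0 < \int[lebesgue3]_x (f x)%:E)%E) :
  ~ exists u : R * R3 R -> R,
      global_weak_solution (monomial_fields R k s1 s2) p f u0 u.
Proof.
move=> [u [[mu _] hweak]].
pose N := (s1 + s2 + s2 * k + k + 1)%N.
have hpN : p < N.+2%:R / N%:R by move: hp2; rewrite /N !addn1 addn3.
have p10 : 0 < p - 1 by rewrite subr_gt0.
pose q := (p - 1)^-1.
have q0 : 0 < q by rewrite invr_gt0.
(* Makes n+1 = m-2 at least 2/(p-1), as [young_absorb] requires. *)
pose n := Num.truncn (2 * q).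
have hn : 2 * q <= n.+1%:R by rewrite ltW// truncnS_gt.
pose m := n.+3.
pose wt := hwt k s1 s2.
have [c c0 [r0 r01 hc]] := integral_cut3_ge wt m f (hwt_gt0 k s1 s2) hf.1 hfpos.
(* On (0, tau/2) the time profile is at least 1/2, so the term in [f] is at least c 2^(-m) tau/2 =
   kappa tau. *)
pose kappa := c * 2^-1 ^+ m / 2.
have kappa0 : 0 < kappa by rewrite divr_gt0// mulr_gt0// exprn_gt0.
pose C : R := 12 * m%:R ^+ 2.
have C0 : 0 < C by rewrite mulr_gt0// exprn_gt0.
(* The box has volume 8 r^Q, so a bound by kappa/32 becomes kappa/4 in [hL]. *)
have kappa32 : 0 < kappa / 32 by rewrite divr_gt0.
have [r rr0 hr] := choose_scale N p C (kappa / 32) r0 hp1 hpN C0 kappa32 r01.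
have rgt0 : 0 < r by apply: lt_le_trans rr0; apply: lt_le_trans r01.
pose a := scale wt r.
have a0 i : 0 < a i by rewrite exprn_gt0.
pose V := 8 * (a 0 * a 1 * a 2).
have VE : V = 8 * r ^+ N.+2 by rewrite /V /a prod_scale_hwt.
have V0 : 0 <= V by rewrite VE mulr_ge0// exprn_ge0// ltW.
pose B := fine (\int[lebesgue3]_x (u0 x * cut3 a x ^+ m)%:E)%E.
(* With [r] fixed, [B] does not depend on [tau], since the time profile is 1 at time 0. *)
have key tau : 0 < tau -> kappa * tau + B <=
    m%:R / tau * (4 * (m%:R / tau)) `^ q * V * tau
    + C / r ^+ 2 * (4 * (C / r ^+ 2)) `^ q * V * tau.
  move=> tau0.
  have psi_ge0 t x : times +oo%E t -> 0 <= psi m tau a t x.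
    by move=> _; rewrite psiE exprn_ge0// mulr_ge0 ?tcut_ge0 ?cut3_ge0.
  have := hweak _ (test_function_psi n tau a tau0 a0) psi_ge0.
  have psi00 : psi n.+3 tau a 0 = fun x => cut3 a x ^+ m.
    by apply/funext => x; rewrite psiE /tcut mul0r subr0 max_r// mul1r.
  rewrite psi00.
  move/absorb_ineq; apply.
  - apply: integral_ge0 => t _; apply: integral_ge0 => x _.
    rewrite lee_fin mulr_ge0 ?powR_ge0// psiE exprn_ge0//.
    by rewrite mulr_ge0 ?tcut_ge0 ?cut3_ge0.
  - apply: (@le_trans _ _ (\int[lebesgue_measure]_(t in pos_times +oo%E)
      (c * 2^-1 ^+ m * \1_(`]0, (tau / 2)[%classic) t)%:E)%E).
      rewrite (_ : kappa * tau = c * 2^-1 ^+ m * (tau / 2)); last by rewrite /kappa; ring.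
      have cm0 : (0 <= (c * 2^-1 ^+ m)%:E)%E by rewrite lee_fin mulr_ge0 ?exprn_ge0// ltW.
      have mi : measurable_fun (pos_times +oo%E : set (measurableTypeR R))
          (fun t => (\1_(`]0, (tau / 2)[%classic) t : R)%:E) by apply/measurable_EFinP.
      have mP := @measurable_pos_times R.
      under eq_integral do rewrite EFinM.
      rewrite ge0_integralZl// integral_indic// EFinM lee_wpmul2l//.
      rewrite setIidl; last by rewrite pos_timesE => t /=; rewrite !in_itv /= => /andP[->].
      rewrite le_eqVlt; apply/orP; left; apply/eqP/esym.
      apply: (etrans (lebesgue_measure_itv _)).
      by rewrite /= lte_fin divr_gt0// sube0.
    apply: le_integral_ge0 => t [t0 _].
      by rewrite EFinM mule_ge0// lee_fin ?indicE// mulr_ge0 ?exprn_ge0// ltW.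
    apply: (@le_trans _ _ (tcut tau t ^+ m * c)%:E).
      rewrite lee_fin -[leLHS]mulrA [leLHS]mulrC ler_wpM2r ?(ltW c0)//.
      rewrite indicE; case: (boolP (_ \in _)) => [|_]; last first.
        by rewrite mulr0 exprn_ge0// tcut_ge0.
      rewrite inE /= in_itv /= => /andP[_ t2]; rewrite mulr1.
      rewrite lerXn2r ?nnegrE ?tcut_ge0// /tcut le_max; apply/orP; right.
      suff : t / tau <= 2^-1 by lra.
      by rewrite ler_pdivrMr// mulrC ltW.
    have := hc r (tcut tau t ^+ m) rr0 (exprn_ge0 _ (tcut_ge0 _ _)).
    by under [X in _ -> (_ <= X)%E]eq_integral do rewrite /psi bump3E.
  - apply: (integral_absorb p tau (m%:R / tau) n a u
      (fun z => derive1 (psi n.+3 tau a ^~ z.2) z.1)) => //.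
      by rewrite divr_ge0// ltW.
    by move=> t x t0; exact: derive1_psi_le.
  - apply: (integral_absorb p tau (C / r ^+ 2) n a u
      (fun z => sub_laplacian (monomial_fields R k s1 s2) (psi n.+3 tau a z.1) z.2)) => //.
      by rewrite divr_ge0// ?exprn_ge0// ltW.
    by move=> t x t0; exact: sub_laplacian_psi_le.
have hL : C / r ^+ 2 * (4 * (C / r ^+ 2)) `^ q * V <= kappa / 4.
  rewrite VE.
  move: hr; rewrite -/q; set X := _ * (_ `^ _); lra.
(* The first entry makes 4m/tau <= 1, so the time-derivative term stays below m V; the second lets
   kappa tau dominate m V - B. *)
pose tau := Num.max (4 * m%:R) (2 * (m%:R * V - B) / kappa + 1).
have tau4 : 4 * m%:R <= tau by rewrite le_max lexx.
have tau0 : 0 < tau by apply: lt_le_trans tau4; rewrite mulr_gt0.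
have tauB : 2 * (m%:R * V - B) + kappa <= kappa * tau.
  have h : 2 * (m%:R * V - B) / kappa + 1 <= tau by rewrite le_max lexx orbT.
  rewrite [leLHS](_ : _ = kappa * (2 * (m%:R * V - B) / kappa + 1)); last by field; rewrite gt_eqF.
  by rewrite ler_wpM2l// ltW.
have hD : m%:R / tau * (4 * (m%:R / tau)) `^ q * V * tau <= m%:R * V.
  have m1 : (4 * (m%:R / tau)) `^ q <= 1.
    rewrite [leRHS](_ : 1 = 1 `^ q); last by rewrite powR1.
    apply: ge0_ler_powR; rewrite ?nnegrE ?(ltW q0)//.
      by rewrite mulr_ge0// divr_ge0// ltW.
    by rewrite mulrA ler_pdivrMr// mul1r.
  rewrite [leLHS](_ : _ = (4 * (m%:R / tau)) `^ q * (m%:R * V)).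
    by rewrite ler_piMl// mulr_ge0.
  by field; rewrite gt_eqF.
(* [key] yields (3/4) kappa tau <= m V - B, while [tauB] gives m V - B <= (kappa tau - kappa)/2: a
   contradiction, as kappa and tau are positive. *)
have := key tau tau0.
have : C / r ^+ 2 * (4 * (C / r ^+ 2)) `^ q * V * tau <= kappa / 4 * tau.
  by rewrite ler_wpM2r// ltW.
have : 0 < kappa * tau by rewrite mulr_gt0.
lra.
Qed.
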